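(* Let $(\mathfrak g,A,\varphi)$ be a $7$-dimensional almost Abelian Lie algebra with coclosed $\mathrm G_2$-structure $\varphi$. If $A\in\mathfrak{sp}(\mathbb R^6)$ is skew-symmetric, then $(\mathfrak g,A,\varphi)$ is an algebraic soliton for the Laplacian coflow.
   Context: Almost Abelian setting: $\mathfrak g$ is a $7$-dimensional Lie algebra with an Abelian ideal $\mathfrak h\cong\mathbb R^6$ of codimension one, with a $\mathrm G_2$-structure which in an orthonormal basis $e_1,\dots,e_7$ with $\mathfrak h=\mathrm{span}(e_1,\dots,e_6)$ is $\varphi=\omega\wedge e^7+\rho^+$, where $\omega=e^{12}+e^{34}+e^{56}$, $\rho^+=e^{135}-e^{146}-e^{245}-e^{236}$. The dual form is $\psi=*\varphi$, and $J$ is the complex structure on $\mathbb R^6$ with $\omega=\langle J\cdot,\cdot\rangle$. The bracket is encoded by $A=\mathrm{ad}(e_7)|_{\mathfrak h}\in\mathfrak{gl}(\mathbb R^6)$. The structure is coclosed ($\mathrm d\psi=0$) iff $A\in\mathfrak{sp}(\mathbb R^6)=\{A: AJ+JA^t=0\}$. For $B\in\mathfrak{gl}(\mathfrak g)$, $\theta(B)\psi=-\psi(B\cdot,\cdot,\cdot,\cdot)-\dots-\psi(\cdot,\cdot,\cdot,B\cdot)$. $Q_A$ is the symmetric endomorphism of $\mathfrak g$ with $\Delta_A\psi=\theta(Q_A)\psi$, where $\Delta_A$ is the Hodge Laplacian on left-invariant forms; it is block diagonal with respect to $\mathfrak h\oplus\mathbb Re_7$ with blocks $\frac12[A,A^t]+\frac12S_A\circ_6S_A$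 and $-\frac12\operatorname{tr}S_A^2-\frac14(\operatorname{tr}JA)^2$, where $S_A=\frac12(A+A^t)$ and $(S\circ_6S)_{ab}=S_{mn}S_{pq}\rho^+_{mpa}\rho^+_{nqb}$. $(\mathfrak g,A,\varphi)$ is an algebraic soliton for the Laplacian coflow if $Q_A=cI_7+\frac12(D+D^t)$ for some $c\in\mathbb R$ and some derivation $D$ of $\mathfrak g$ such that $D^t$ is also a derivation. *)

(* Defs.v *)
From mathcomp Require Import all_boot all_order all_algebra.
From mathcomp Require Import reals.

Set Implicit Arguments.
Unset Strict Implicit.
Unset Printing Implicit Defensive.

Import GRing.Theory Num.Theory.
Local Open Scope ring_scope.

(* Vectors are columns, so that a matrix B acts by x |-> B *m x.  A k-form on
   R^n is a function of an n x k matrix whose columns are its k arguments; the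
   forms built below are all alternating and multilinear in the columns.
   The standard basis e_1, ..., e_n is orthonormal. *)
Definition form (R : realFieldType) (n k : nat) := 'M[R]_(n, k) -> R.

Section ExteriorAlgebra.
Variable R : realFieldType.

(* [ecov n [:: i1; ...; ik]] is the form e^{i1...ik} on R^(n+1), with indices
   counted from 1 as on paper. *)
Definition ecov (n : nat) (s : seq nat) : form R n.+1 (size s) :=
  fun X => \det (rowsub (fun m : 'I_(size s) => inord (nth 1%N s m).-1) X).

(* Exterior product of a k-form with a 1-form placed on the right: moving
   column j to the last place costs k - j transpositions. *)
Definition wedge1 (n k : nat) (a : form R n k) (b : form R n 1) :
    form R n k.+1 :=
  fun X => \sum_(j < k.+1) (-1) ^+ (k - j) * a (col' j X) * b (col j X).

(* Hodge star on R^(k+l), oriented by e^{1...(k+l)}: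
   ( *a)_J = (1/k!) \sum_I a_I epsilon_{IJ}, I ranging over all k-tuples. *)
Definition hodge (k l : nat) (a : form R (k + l) k) : form R (k + l) l :=
  fun X => (k`!)%:R^-1 *
    \sum_(f : {ffun 'I_k -> 'I_(k + l)})
      a (\matrix_(i, j) (i == f j)%:R)
      * \det (row_mx (\matrix_(i, j) (i == f j)%:R) X).

(* theta(B) a = - a(B., ., ...) - ... - a(., ..., B.) *)
Definition theta (n k : nat) (B : 'M[R]_n) (a : form R n k) : form R n k :=
  fun X => - \sum_(j < k)
    a (\matrix_(i, m) (if m == j then (B *m X) i m else X i m)).

(* Chevalley-Eilenberg differential of left-invariant forms:
   da(x_0, ..., x_(k+1)) =
     \sum_(i < j) (-1)^(i+j) a([x_i, x_j], x_0, .. ^i .. ^j .., x_(k+1)).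
   For i < j, column i of [col' j X] is column i of X. *)
Definition dform (n k : nat) (br : 'cV[R]_n -> 'cV[R]_n -> 'cV[R]_n)
    (a : form R n k.+1) : form R n k.+2 :=
  fun X => \sum_(j < k.+2) \sum_(i < k.+1 | (i < j)%N)
    (-1) ^+ (i + j) *
    a (row_mx (br (col i (col' j X)) (col j X)) (col' i (col' j X))).

End ExteriorAlgebra.

Arguments ecov {R n} s X.

Section G2.
Variable R : realFieldType.

(* omega and rho^+ on R^6 (n = 5), or pulled back to R^7 (n = 6). *)
Definition omega (n : nat) : form R n.+1 2 := fun X =>
  ecov [:: 1; 2]%N X + ecov [:: 3; 4]%N X + ecov [:: 5; 6]%N X.

Definition rho_plus (n : nat) : form R n.+1 3 := fun X =>
  ecov [:: 1; 3; 5]%N X - ecov [:: 1; 4; 6]%N X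
  - ecov [:: 2; 4; 5]%N X - ecov [:: 2; 3; 6]%N X.

Definition phi : form R 7 3 := fun X =>
  wedge1 (@omega 6) (@ecov R 6 [:: 7]%N) X + @rho_plus 6 X.

Definition psi : form R 7 4 := @hodge R 3 4 phi.

(* omega = <J., .>, that is J_{ij} = <J e_j, e_i> = omega(e_j, e_i). *)
Definition Jmx : 'M[R]_6 :=
  \matrix_(i, j) @omega 5 (@row_mx R 6 1 1 (delta_mx j 0) (delta_mx i 0)).

Definition sp6 (A : 'M[R]_6) : Prop := A *m Jmx + Jmx *m A^T = 0.

Variable br : 'cV[R]_7 -> 'cV[R]_7 -> 'cV[R]_7.

Definition lie_bracket : Prop :=
  [/\ forall (c : R) x y z, br (c *: x + y) z = c *: br x z + br y z,
      forall (c : R) x y z, br x (c *: y + z) = c *: br x y + br x z,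
      forall x, br x x = 0
    & forall x y z, br x (br y z) + br y (br z x) + br z (br x y) = 0].

(* The inclusion of h = span(e_1, ..., e_6) = R^6 in R^7. *)
Definition inh (x : 'cV[R]_6) : 'cV[R]_7 := @col_mx R 6 1 1 x 0.

Definition e7 : 'cV[R]_7 := delta_mx ord_max ord0.

(* R^7 with the bracket br is a Lie algebra, h is an Abelian ideal, and A is
   the matrix of ad(e_7) on h. *)
Definition almost_abelian (A : 'M[R]_6) : Prop :=
  [/\ lie_bracket,
      forall x y, br (inh x) (inh y) = 0
    & forall x, br e7 (inh x) = inh (A *m x)].

Definition coclosed : Prop := dform br psi =1 fun=> 0.

(* In dimension 7 the codifferential on k-forms is (-1)^k * d *. *)
Definition codiff4 (a : form R 7 4) : form R 7 3 :=
  @hodge R 4 3 (dform br (@hodge R 4 3 a)).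

Definition codiff5 (a : form R 7 5) : form R 7 4 :=
  fun X => - @hodge R 3 4 (dform br (@hodge R 5 2 a)) X.

Definition laplacian4 (a : form R 7 4) : form R 7 4 :=
  fun X => dform br (codiff4 a) X + codiff5 (dform br a) X.

Definition derivation (D : 'M[R]_7) : Prop :=
  forall x y, D *m br x y = br (D *m x) y + br x (D *m y).

(* Q is the endomorphism Q_A; it is unique because B |-> theta(B) psi is
   injective on symmetric endomorphisms. *)
Definition is_QA (Q : 'M[R]_7) : Prop :=
  Q^T = Q /\ laplacian4 psi =1 theta Q psi.

Definition algebraic_soliton : Prop :=
  exists2 Q : 'M[R]_7, is_QA Q &
    exists (c : R) (D : 'M[R]_7),
      [/\ derivation D, derivation D^T
        & Q = c%:M + 2^-1 *: (D + D^T)].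

End G2.

(* Main.v *)
Require Import Defs.
From mathcomp Require Import all_boot all_order all_algebra.
From mathcomp Require Import perm reals ring zify.
Local Open Scope ring_scope.

(** Write [A^] for the endomorphism [ext6 A] of [R^7] that is [A] on [h] and
    kills [e_7], and [rho^-] for [e^136 + e^145 + e^235 - e^246].  Then
    [rho^+ + i rho^-] is the complex volume form
    [(e^1 + i e^2) (e^3 + i e^4) (e^5 + i e^6)] of [(h, J)], and
    [psi = omega^2 / 2 + rho^- /\ e^7].

    A skew-symmetric [A] in [sp] commutes with [J], so it lies in [u(3)]: it
    kills [omega], and it acts on the complex volume form through its complex
    trace, which is purely imaginary, say [i tau].  Hence
    [theta(A^) omega = 0] and [theta(A^) rho^+ = tau rho^-]
    ([theta_unitary]).

    The bracket is [[x, y] = x_7 A^ y - y_7 A^ x], so on [k]-forms the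
    differential is [(-1)^k theta(A^) a /\ e^7] ([dform_almost_abelian]).
    This gives [d phi = d rho^+ = - tau rho^- /\ e^7].  As [* psi = phi],
    [* (rho^- /\ e^7) = rho^+] and [d psi = 0], the Laplacian of [psi] is
    [d * d * psi = tau^2 rho^- /\ e^7] ([laplacian_psi]).

    An endomorphism that scales [e_7] by [q] and kills [h] maps [psi] to
    [- q rho^- /\ e^7] under [theta] ([theta_psi]).  So [Q_A] is that
    endomorphism for [q = - tau^2], and [Q_A - q I] is [- q] on [h] and [0]
    on [e_7]: a symmetric derivation, because the bracket maps [e_7] and [h]
    to [h] and vanishes on [h].  This is the soliton equation with [c = q]. *)

Set Implicit Arguments.
Unset Strict Implicit.
Unset Printing Implicit Defensive.
Import GRing.Theory Num.Theory.

(** * Minors and the Hodge star *)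

Section Hodge.
Variable R : realFieldType.

(** The form [e^{I_1} /\ ... /\ e^{I_k}]; [ecov] is the case where the indices
    come from a list. *)
Definition minor (n k : nat) (I : 'I_k -> 'I_n) (X : 'M[R]_(n, k)) :=
  \det (rowsub I X).

Definition basis_mx (n k : nat) (I : 'I_k -> 'I_n) : 'M[R]_(n, k) :=
  \matrix_(i, j) (i == I j)%:R.

Lemma rowsub_basis_mx n k l (I : 'I_k -> 'I_n) (X : 'M[R]_(n, l)) :
  rowsub I X = (basis_mx I)^T *m X.
Proof.
apply/matrixP=> i j; rewrite !mxE (bigD1 (I i)) //= !mxE eqxx mul1r.
by rewrite big1 ?addr0 // => m /negPf Hm; rewrite !mxE Hm mul0r.
Qed.

Lemma det_basis_row_perm k l (I : 'I_k -> 'I_(k + l)) (s : 'S_k)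
    (X : 'M[R]_(k + l, l)) :
  \det (row_mx (basis_mx (I \o s)) X) =
  (-1) ^+ s * \det (row_mx (basis_mx I) X).
Proof.
have -> : row_mx (basis_mx (I \o s)) X =
    row_mx (basis_mx I) X *m block_mx (perm_mx s)^T 0 0 1%:M.
  rewrite mul_row_block !mulmx0 mulmx1 add0r addr0; congr row_mx.
  apply/matrixP=> i j; rewrite !mxE (bigD1 (s j)) //= !mxE eqxx mulr1.
  by rewrite big1 ?addr0 // => m /negPf Hm; rewrite !mxE [s j == _]eq_sym Hm mulr0.
by rewrite det_mulmx det_ublock det1 mulr1 det_tr det_perm mulrC.
Qed.

(** The [k!] permutations in the Leibniz expansion of the minor all contribute
    the same amount to the sum over [k]-tuples, since the second determinant is
    alternating too; this cancels the normalising factor. *)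
Lemma hodge_minor k l (I : 'I_k -> 'I_(k + l)) :
  @hodge R k l (minor I) =1 fun X => \det (row_mx (basis_mx I) X).
Proof.
move=> X; rewrite /hodge.
have -> : \sum_(f : {ffun 'I_k -> 'I_(k + l)})
    minor I (basis_mx f) * \det (row_mx (basis_mx f) X) =
  \sum_(s : 'S_k) \det (row_mx (basis_mx I) X).
  under eq_bigr => f _.
    rewrite /minor -det_tr {1}/determinant big_distrl /=.
  over.
  rewrite exchange_big; apply: eq_bigr => s _ /=.
  rewrite (bigD1 [ffun j => I (s j)]) //= [X in _ + X]big1 ?addr0.
    rewrite [X in _ * X * _]big1 => [|j _]; last by rewrite !mxE ffunE eqxx.
    have -> : basis_mx [ffun j => I (s j)] = basis_mx (I \o s).
      by apply/matrixP=> i j; rewrite !mxE ffunE.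
    by rewrite mulr1 det_basis_row_perm mulrA -signr_addb addbb mul1r.
  move=> f fI; have /existsP [j Hj] : [exists j, f j != I (s j)].
    apply/contraT; rewrite negb_exists => /forallP H; case/eqP: fI.
    by apply/ffunP=> j; rewrite ffunE; apply/eqP; move: (H j); rewrite negbK.
  by rewrite (bigD1 j) //= !mxE eq_sym (negPf Hj) mul0r mulr0 mul0r.
by rewrite sumr_const card_Sn -[X in _ * X]mulr_natl mulrA mulVf ?mul1r // pnatr_eq0 -lt0n fact_gt0.
Qed.

(** Multiplying [(E_I | X)] on the left by [(E_I | E_K)^T] makes it block
    triangular with diagonal blocks [1] and the [K]-rows of [X]. *)
Lemma hodge_minor_disjoint k l (I : 'I_k -> 'I_(k + l)) (K : 'I_l -> 'I_(k + l))
    (X : 'M[R]_(k + l, l)) :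
    injective I -> (forall i j, I i != K j) ->
  \det (row_mx (basis_mx I) (basis_mx K)) * @hodge R k l (minor I) X =
  minor K X.
Proof.
move=> injI disjIK; rewrite hodge_minor -det_tr -det_mulmx mul_mx_row.
have -> : (row_mx (basis_mx I) (basis_mx K))^T *m basis_mx I =
    col_mx 1%:M 0.
  rewrite tr_row_mx mul_col_mx -!rowsub_basis_mx; congr col_mx.
    by apply/matrixP=> i j; rewrite !mxE (inj_eq injI).
  by apply/matrixP=> i j; rewrite !mxE eq_sym (negPf (disjIK j i)).
rewrite tr_row_mx mul_col_mx -!rowsub_basis_mx -block_mxEh.
by rewrite det_ublock det1 mul1r.
Qed.

Fixpoint inversions (s : seq nat) : nat :=
  if s is a :: s' then count (ltn^~ a) s' + inversions s' else 0%N.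

(** Removing the value [a] shifts the others monotonically. *)
Lemma inversions_unbump a s :
  a \notin s -> inversions [seq unbump a x | x <- s] = inversions s.
Proof.
elim: s => //= x s IHs; rewrite inE negb_or => /andP[ax as_].
rewrite IHs // count_map; congr (_ + _)%N; apply: eq_in_count => y ys /=.
have ay : a != y by apply: contraNneq as_ => ->.
by rewrite /unbump; lia.
Qed.

Lemma count_iota_lt a n : (a <= n)%N -> count (ltn^~ a) (iota 0 n) = a.
Proof.
move=> an; rewrite -(subnKC an) iotaD count_cat.
rewrite (_ : count _ (iota 0 a) = size (iota 0 a)); last first.
  by apply/eqP; rewrite -all_count; apply/allP=> x; rewrite mem_iota.
rewrite size_iota add0n -[RHS]addn0; congr (_ + _)%N; apply/eqP.
rewrite -leqn0 leqNgt -has_count; apply/hasPn=> x.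
by rewrite mem_iota -leqNgt => /andP[].
Qed.

(** Expanding along the first column removes the row of the first value [a] with
    sign [(-1)^a], and in a permutation exactly [a] later values are smaller
    than [a].  Counting inversions makes the sign of a concrete permutation
    matrix computable. *)
Lemma det_arrangement n (s : seq nat) :
    perm_eq s (iota 0 n) ->
  \det (\matrix_(i < n, j < n) (i == nth 0%N s j :> nat)%:R) =
  (-1) ^+ inversions s :> R.
Proof.
elim: n s => [|n IHn] s ps; have := perm_size ps; rewrite size_iota.
  by move/size0nil->; rewrite det_mx00.
case: s ps => //= a s ps [ss].
have /= /andP[as_ us] : uniq (a :: s) by rewrite (perm_uniq ps) (iota_uniq 0 n.+1).
have sn x : x \in a :: s -> (x < n.+1)%N by rewrite (perm_mem ps) (mem_iota 0 n.+1).
have an := sn a (mem_head _ _).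
have -> : count (ltn^~ a) s = a.
  have /seq.permP/(_ (ltn^~ a)) := ps; rewrite [RHS](@count_iota_lt a n.+1) /= ?ltnn //.
  exact: ltnW.
rewrite (expand_det_col _ ord0) (bigD1 (Ordinal an)) //= big1 ?addr0.
  rewrite mxE /= eqxx mul1r /cofactor addn0 exprD; congr (_ * _).
  rewrite -(inversions_unbump as_) -IHn.
    congr (\det _); apply/matrixP=> i j; rewrite !mxE /= (nth_map 0%N) ?ss //.
    have xa : nth 0%N s j != a.
      by apply: contraNneq as_ => <-; rewrite mem_nth ?ss.
    by rewrite -[nat_of_ord i == _](can_eq (@bumpK a)) unbumpKcond (negPf xa).
  have um : uniq [seq unbump a x | x <- s].
    rewrite map_inj_in_uniq // => x y xs ys.
    have xa : x != a by apply: contraNneq as_ => <-.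
    have ya : y != a by apply: contraNneq as_ => <-.
    by rewrite /unbump; lia.
  apply: uniq_perm; rewrite ?iota_uniq // => y.
  apply: (uniq_min_size um _ _).2; last by rewrite size_map size_iota ss.
  move=> _ /mapP [x xs ->]; rewrite mem_iota.
  have xa : x != a by apply: contraNneq as_ => <-.
  by move: (sn x (@mem_behead _ (a :: s) x xs)); rewrite /unbump /=; lia.
move=> i ia; rewrite mxE /=; case: eqP => [e|_]; last by rewrite mul0r.
by case/eqP: ia; apply: val_inj.
Qed.

Lemma hodge_minor_arrangement k l (I : 'I_k -> 'I_(k + l))
    (K : 'I_l -> 'I_(k + l)) (s t : seq nat) :
    size s = k -> size t = l -> perm_eq (s ++ t) (iota 0 (k + l)) ->
    (forall i, I i = nth 0%N s i :> nat) -> (forall i, K i = nth 0%N t i :> nat) ->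
  @hodge R k l (minor I) =1 fun X => (-1) ^+ inversions (s ++ t) * minor K X.
Proof.
move=> ss st pst Is Kt X.
have ust : uniq (s ++ t) by rewrite (perm_uniq pst) iota_uniq.
have us : uniq s by move: ust; rewrite cat_uniq => /and3P[].
have injI : injective I.
  move=> i j /(congr1 (@nat_of_ord _)); rewrite !Is => /eqP.
  by rewrite nth_uniq ?ss // => /eqP /val_inj.
have disjIK i j : I i != K j.
  apply/eqP=> /(congr1 (@nat_of_ord _)); rewrite Is Kt => e.
  move: ust; rewrite cat_uniq => /and3P[_ /hasPn/(_ (nth 0%N t j)) H _].
  by have := H (mem_nth _ _); rewrite st -e /= mem_nth ?ss // => /(_ (ltn_ord _)).
have detE : \det (row_mx (basis_mx I) (basis_mx K)) = (-1) ^+ inversions (s ++ t).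
  rewrite -(det_arrangement pst).
  congr (\det _); apply/matrixP=> i j; rewrite !mxE.
    rewrite nth_cat ss; case: splitP => m em; rewrite !mxE -val_eqE /=.
      by rewrite Is em.
    by rewrite Kt em addKn.
by rewrite -(hodge_minor_disjoint X injI disjIK) detE mulrA -signr_odd -signr_addb addbb mul1r.
Qed.

Lemma eq_hodge k l (a b : 'M[R]_(k + l, k) -> R) :
  a =1 b -> @hodge R k l a =1 @hodge R k l b.
Proof.
by move=> eab X; congr (_ * _); apply: eq_bigr => f _; rewrite eab.
Qed.

Lemma hodgeD k l (a b : 'M[R]_(k + l, k) -> R) X :
  @hodge R k l (fun Y => a Y + b Y) X = @hodge R k l a X + @hodge R k l b X.
Proof.
by rewrite /hodge -mulrDr -big_split; congr (_ * _); apply: eq_bigr => f _; rewrite mulrDl.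
Qed.

Lemma hodgeZ k l c (a : 'M[R]_(k + l, k) -> R) X :
  @hodge R k l (fun Y => c * a Y) X = c * @hodge R k l a X.
Proof.
rewrite /hodge mulrCA [c * _]mulr_sumr; congr (_ * _).
by apply: eq_bigr => f _; rewrite mulrA.
Qed.

Lemma hodgeN k l (a : 'M[R]_(k + l, k) -> R) X :
  @hodge R k l (fun Y => - a Y) X = - @hodge R k l a X.
Proof.
by rewrite /hodge -mulrN -sumrN; congr (_ * _); apply: eq_bigr => f _; rewrite mulNr.
Qed.

Lemma hodge0 k l : @hodge R k l (fun=> 0) =1 fun=> 0.
Proof. by move=> X; rewrite /hodge big1 ?mulr0 // => f _; rewrite mul0r. Qed.

(** The first list is taken nonempty so that [R^(n+1)], on which [ecov] lives, is
    definitionally of dimension [k + l]. *)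
Lemma hodge_ecov p s t :
    perm_eq [seq i.-1 | i <- p :: s ++ t] (iota 0 (size s + size t).+1) ->
  @hodge R (size (p :: s)) (size t) (@ecov R (size s + size t) (p :: s)) =1
  fun X => (-1) ^+ inversions [seq i.-1 | i <- p :: s ++ t]
           * @ecov R (size s + size t) t X.
Proof.
set N := (size s + size t)%N => pst.
have bound x : x \in p :: s ++ t -> (x.-1 < N.+1)%N.
  by move=> xst; have := perm_mem pst x.-1; rewrite map_f // mem_iota => /esym.
rewrite -[p :: s ++ t]/((p :: s) ++ t) map_cat in pst *.
apply: hodge_minor_arrangement; rewrite ?size_map // => i.
  by rewrite inordK ?(nth_map 1%N) // bound // -cat_cons mem_cat mem_nth.
by rewrite inordK ?(nth_map 1%N) // bound // -cat_cons mem_cat mem_nth ?orbT.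
Qed.

End Hodge.

(** * Alternating forms, derivations and the differential *)

Section Differential.
Variable R : realFieldType.

Definition subst_col n k (j : 'I_k) (u : 'cV[R]_n) (X : 'M[R]_(n, k)) :=
  \matrix_(i, m) (if m == j then u i 0 else X i m).

(** Linearity in each column, and the sign rule for moving a column to the
    front, which is the only consequence of antisymmetry that the
    Chevalley-Eilenberg formula calls for. *)
Definition alternating n k (a : 'M[R]_(n, k.+1) -> R) : Prop :=
  (forall i u (X : 'M[R]_(n, k.+1)),
    a (row_mx u (col' i X) : 'M_(n, 1 + k)) = (-1) ^+ i * a (subst_col i u X)) /\
  (forall i c d u v X, a (subst_col i (c *: u + d *: v) X) =
     c * a (subst_col i u X) + d * a (subst_col i v X)).

Lemma theta_subst_col n k (B : 'M[R]_n) (a : 'M[R]_(n, k) -> R) X :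
  theta B a X = - \sum_(j < k) a (subst_col j (B *m col j X) X).
Proof.
congr (- _); apply: eq_bigr => j _; congr a; apply/matrixP=> i m.
rewrite !mxE; case: eqP => // ->; apply: eq_bigr => p _.
by rewrite !mxE.
Qed.

Lemma det_subst_col k (X : 'M[R]_k) (j : 'I_k) u :
  \det (subst_col j u X) = (\adj X *m u) j 0.
Proof.
rewrite (expand_det_col _ j) mxE; apply: eq_bigr => i _.
rewrite !mxE eqxx mulrC; congr (_ * \det _ * _).
by apply/matrixP=> p q; rewrite !mxE eq_sym (negPf (neq_lift _ _)).
Qed.

Lemma rowsub_subst_col n k m (I : 'I_m -> 'I_n) (j : 'I_k) u X :
  rowsub I (subst_col j u X) = subst_col j (rowsub I u) (rowsub I X).
Proof. by apply/matrixP=> i p; rewrite !mxE. Qed.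

Lemma alternating_minor n k (I : 'I_k.+1 -> 'I_n) : alternating (minor (R:=R) I).
Proof.
split=> [i u X | i c d u v X]; rewrite /minor; last first.
  by rewrite !rowsub_subst_col !det_subst_col linearD !linearZ /= mulmxDr -!scalemxAr !mxE.
rewrite rowsub_subst_col (expand_det_col _ 0) (expand_det_col _ i) mulr_sumr.
apply: eq_bigr => p _; rewrite !mxE eqxx /cofactor.
case: splitP => // q _; rewrite ord1 [RHS]mulrCA; congr (_ * _).
rewrite mulrA -exprD addn0 addnCA addnn exprD -[X in _ * X * _]signr_odd odd_double mulr1.
congr (_ * \det _); apply/matrixP=> s t; rewrite !mxE.
rewrite eq_sym (negPf (neq_lift _ _)).
case: splitP => [t' /esym|t' e]; first by case: t'=> [[]].
by rewrite !mxE; congr (X _ (lift _ _)); apply: val_inj; move: e => /= [].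
Qed.

Lemma alternatingD n k (a b : 'M[R]_(n, k.+1) -> R) :
  alternating a -> alternating b -> alternating (fun X => a X + b X).
Proof.
move=> [a1 a2] [b1 b2]; split=> [i u X|i c d u v X].
  by rewrite a1 b1 mulrDr.
by rewrite a2 b2; ring.
Qed.

Lemma alternatingN n k (a : 'M[R]_(n, k.+1) -> R) :
  alternating a -> alternating (fun X => - a X).
Proof.
move=> [a1 a2]; split=> [i u X|i c d u v X]; first by rewrite a1 mulrN.
by rewrite a2; ring.
Qed.

Lemma eq_dform n k (br : 'cV[R]_n -> 'cV[R]_n -> 'cV[R]_n)
    (a b : 'M[R]_(n, k.+1) -> R) : a =1 b -> dform br a =1 dform br b.
Proof.
by move=> eab X; apply: eq_bigr => j _; apply: eq_bigr => i _; rewrite eab.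
Qed.

Lemma dform_scale n k (br : 'cV[R]_n -> 'cV[R]_n -> 'cV[R]_n) c
    (a : 'M[R]_(n, k.+1) -> R) X :
  dform br (fun Y => c * a Y) X = c * dform br a X.
Proof.
rewrite mulr_sumr; apply: eq_bigr => j _; rewrite mulr_sumr.
by apply: eq_bigr => i _; rewrite mulrCA.
Qed.

Lemma dform0 n k (b : 'cV[R]_n -> 'cV[R]_n -> 'cV[R]_n) :
  dform b (fun _ : 'M[R]_(n, k.+1) => 0) =1 fun=> 0.
Proof.
by move=> X; rewrite /dform big1 // => j _; rewrite big1 // => i _; rewrite mulr0.
Qed.

Lemma eq_theta n k (B : 'M[R]_n) (a b : 'M[R]_(n, k) -> R) :
  a =1 b -> theta B a =1 theta B b.
Proof. by move=> eab X; congr (- _); apply: eq_bigr => j _; rewrite eab. Qed.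

Lemma thetaD n k (B : 'M[R]_n) (a b : 'M[R]_(n, k) -> R) X :
  theta B (fun Y => a Y + b Y) X = theta B a X + theta B b X.
Proof. by rewrite /theta big_split opprD. Qed.

Lemma thetaN n k (B : 'M[R]_n) (a : 'M[R]_(n, k) -> R) X :
  theta B (fun Y => - a Y) X = - theta B a X.
Proof. by rewrite /theta sumrN. Qed.

(** Jacobi's formula for the derivative of a determinant. *)
Lemma theta_minor n k (B : 'M[R]_n) (I : 'I_k -> 'I_n) X :
  theta B (minor I) X = - \tr (\adj (rowsub I X) *m rowsub I (B *m X)).
Proof.
rewrite theta_subst_col; congr (- _); apply: eq_bigr => j _.
rewrite /minor rowsub_subst_col det_subst_col !mxE; apply: eq_bigr => p _.
by rewrite !mxE; congr (_ * _); apply: eq_bigr => q _; rewrite !mxE.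
Qed.

(** [e^I] is a weight vector for diagonal endomorphisms. *)
Lemma theta_diag_minor n k (b : 'rV[R]_n) (I : 'I_k -> 'I_n) X :
  theta (diag_mx b) (minor I) X = - (\sum_j b 0 (I j)) * minor I X.
Proof.
rewrite theta_minor.
have -> : rowsub I (diag_mx b *m X) = diag_mx (colsub I b) *m rowsub I X.
  by apply/matrixP=> i j; rewrite !mul_diag_mx !mxE.
rewrite mxtrace_mulC -mulmxA mul_mx_adj mul_mx_scalar mxtraceZ mxtrace_diag.
by rewrite mulNr mulrC; congr (- (_ * _)); apply: eq_bigr => j _; rewrite !mxE.
Qed.

(** A pair [(j, i)] stands for the ordered pair of distinct columns
    [(j, lift j i)]; this exchanges the two columns. *)
Definition swap_pair k (p : 'I_k.+2 * 'I_k.+1) : 'I_k.+2 * 'I_k.+1 :=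
  (lift p.1 p.2, odflt p.2 (unlift (lift p.1 p.2) p.1)).

Lemma swap_pairE k (p : 'I_k.+2 * 'I_k.+1) :
  lift (swap_pair p).1 (swap_pair p).2 = p.1.
Proof.
case: p => j i /=; have ji : lift j i != j by rewrite eq_sym neq_lift.
by have [i' e ->] := unlift_some ji; rewrite -e.
Qed.

Lemma swap_pairK k : involutive (@swap_pair k).
Proof.
move=> p; have := swap_pairE (swap_pair p); have := swap_pairE p.
case: p => j i; set q := swap_pair _ => e1 e2.
have e3 : (swap_pair q).1 = j by [].
rewrite [LHS]surjective_pairing e3; congr (_, _).
by move: e2; rewrite e3 /= => /lift_inj.
Qed.

(** The condition [i < j] says that the second column comes before the first. *)
Lemma swap_pair_lt k (p : 'I_k.+2 * 'I_k.+1) :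
  ((swap_pair p).2 < (swap_pair p).1)%N = ~~ (p.2 < p.1)%N.
Proof.
have := congr1 val (swap_pairE p); have: (swap_pair p).1 = lift p.1 p.2 by [].
move=> /(congr1 val); case: p => j i /=; rewrite /bump; lia.
Qed.

Lemma col'_swap_pair n k (X : 'M[R]_(n, k.+2)) (p : 'I_k.+2 * 'I_k.+1) :
  col' (swap_pair p).2 (col' (swap_pair p).1 X) = col' p.2 (col' p.1 X).
Proof.
apply/matrixP=> r m; rewrite !mxE; congr (X _ _); apply: val_inj => /=.
have := congr1 val (swap_pairE p); have: (swap_pair p).1 = lift p.1 p.2 by [].
move=> /(congr1 val); case: p => j i /=; rewrite /bump; lia.
Qed.

(** For [[x, y] = l(x) B y - l(y) B x] each pair of columns contributes two
    terms, exchanged by swapping the pair.  So the sum over unordered pairs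
    becomes a sum over ordered pairs: a choice of the column [j] fed to [l] and
    of the column that [B] acts on.  This is [l] wedged with [theta(B) a]. *)
Lemma dform_rank_one n (l : 'cV[R]_n -> R) (B : 'M[R]_n)
    (br : 'cV[R]_n -> 'cV[R]_n -> 'cV[R]_n) k (a : 'M[R]_(n, k.+1) -> R) X :
    (forall x y, br x y = l x *: (B *m y) - l y *: (B *m x)) -> alternating a ->
  dform br a X = \sum_(j < k.+2) (-1) ^+ j * l (col j X) * theta B a (col' j X).
Proof.
move=> brE [aR aL].
pose t (p : 'I_k.+2 * 'I_k.+1) := - ((-1) ^+ p.1 * l (col p.1 X) *
   a (subst_col p.2 (B *m col p.2 (col' p.1 X)) (col' p.1 X))).
have col'E (p : 'I_k.+2 * 'I_k.+1) : col p.2 (col' p.1 X) = col (lift p.1 p.2) X.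
  by apply/matrixP=> r m; rewrite !mxE.
transitivity (\sum_(p : 'I_k.+2 * 'I_k.+1 | (p.2 < p.1)%N) (t (swap_pair p) + t p)).
  rewrite /dform pair_big_dep /=; apply: eq_bigr => p ij.
  rewrite brE -scaleNr aR mulrA aL.
  have -> : a (subst_col p.2 (B *m col p.1 X) (col' p.1 X)) = (-1) ^+ p.2 *
      ((-1) ^+ (swap_pair p).2 * a (subst_col (swap_pair p).2
        (B *m col p.1 X) (col' (swap_pair p).1 X))).
    rewrite -aR col'_swap_pair aR mulrA -exprD -signr_odd oddD addbb mul1r.
    by [].
  rewrite /t !col'E swap_pairE.
  (* For i < j the swapped pair has indices (i, j - 1). *)
  have sj' : (-1) ^+ (swap_pair p).1 = (-1) ^+ p.2 :> R.
    by congr (_ ^+ _); rewrite /= /bump; lia.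
  have si' : (-1) ^+ (swap_pair p).2 = - (-1) ^+ p.1 :> R.
    have <- : (swap_pair p).2.+1 = p.1 :> nat.
      by have := congr1 val (swap_pairE p); rewrite /= /bump; lia.
    by rewrite exprS mulN1r opprK.
  rewrite sj' si' exprD -[(-1) ^+ p.1]signr_odd -[(-1) ^+ p.2]signr_odd.
  by do 2!case: odd => /=; ring.
rewrite big_split /= (reindex_inj (can_inj (@swap_pairK k))) /=.
under eq_bigl => p do rewrite swap_pair_lt.
under eq_bigr => p _ do rewrite swap_pairK.
transitivity (\sum_p t p).
  by rewrite [RHS](bigID (fun p : 'I_k.+2 * 'I_k.+1 => (p.2 < p.1)%N)) addrC.
rewrite -(pair_bigA _ (fun j i => t (j, i))) /=; apply: eq_bigr => j _.
by rewrite theta_subst_col mulrN mulr_sumr -sumrN.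
Qed.

End Differential.

(** * The forms of the G2-structure *)

Section G2Forms.
Variable R : realFieldType.

(** Laplace expansion along the last row. *)
Lemma wedge1_ecov n (s : seq nat) (t : nat) (X : 'M[R]_(n.+1, (size s).+1)) :
  wedge1 (@ecov R n s) (@ecov R n [:: t]) X =
  \det (rowsub (fun m : 'I_(size s).+1 => inord (nth 1%N (rcons s t) m).-1) X).
Proof.
rewrite (expand_det_row _ ord_max); apply: eq_bigr => j _.
rewrite [ecov [:: t] _]det_mx11 !mxE nth_rcons ltnn eqxx [RHS]mulrC; congr (_ * _).
congr (_ * _).
  by rewrite -signr_odd oddB -1?ltnS // -oddD signr_odd.
congr (\det _); apply/matrixP=> p q; rewrite !mxE; congr (X (inord _.-1) _).
by rewrite lift_max nth_rcons ltn_ord.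
Qed.

Definition omega_e7 (X : 'M[R]_(7, 3)) : R :=
  ecov [:: 1; 2; 7]%N X + ecov [:: 3; 4; 7]%N X + ecov [:: 5; 6; 7]%N X.

Definition phi_ecov (X : 'M[R]_(7, 3)) : R := omega_e7 X + @rho_plus R 6 X.

Definition rho_minus (X : 'M[R]_(7, 3)) : R :=
  ecov [:: 1; 3; 6]%N X + ecov [:: 1; 4; 5]%N X
  + ecov [:: 2; 3; 5]%N X - ecov [:: 2; 4; 6]%N X.

Definition rho_minus7 (X : 'M[R]_(7, 4)) : R :=
  ecov [:: 1; 3; 6; 7]%N X + ecov [:: 1; 4; 5; 7]%N X
  + ecov [:: 2; 3; 5; 7]%N X - ecov [:: 2; 4; 6; 7]%N X.

Definition psi_ecov (X : 'M[R]_(7, 4)) : R :=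
  ecov [:: 3; 4; 5; 6]%N X + ecov [:: 1; 2; 5; 6]%N X
  + ecov [:: 1; 2; 3; 4]%N X + rho_minus7 X.

Lemma phiE : @phi R =1 phi_ecov.
Proof.
move=> X; rewrite /phi_ecov /omega_e7; congr (_ + _).
have e p q : ecov [:: p; q; 7]%N X = wedge1 (@ecov R 6 [:: p; q]) (@ecov R 6 [:: 7]%N) X.
  by rewrite [RHS]wedge1_ecov.
rewrite !e -!big_split /=.
by apply: eq_bigr => j _; rewrite /omega !mulrDr !mulrDl.
Qed.

Lemma wedge1_rho_minus X : wedge1 rho_minus (@ecov R 6 [:: 7]%N) X = rho_minus7 X.
Proof.
rewrite /rho_minus7.
have e p q r : ecov [:: p; q; r; 7]%N X =
    wedge1 (@ecov R 6 [:: p; q; r]) (@ecov R 6 [:: 7]%N) X.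
  by rewrite [RHS]wedge1_ecov.
rewrite !e -sumrN -!big_split /=.
by apply: eq_bigr => j _; rewrite /rho_minus !mulrDr !mulrDl mulrN mulNr.
Qed.

(* The ascriptions state the dimensions 3 + 4 and 4 + 3 as numerals, so that
   the rules match the Hodge stars of 3- and 4-forms on R^7. *)
Local Notation star3 p q r t X :=
  (@hodge_ecov R p [:: q; r] t isT X
    : @hodge R 3 4 (@ecov R 6 [:: p; q; r]) X = _).
Local Notation star4 p q r s t X :=
  (@hodge_ecov R p [:: q; r; s] t isT X
    : @hodge R 4 3 (@ecov R 6 [:: p; q; r; s]) X = _).

Lemma psiE : @psi R =1 psi_ecov.
Proof.
move=> X; rewrite /psi (@eq_hodge _ 3 4 _ _ phiE) /phi_ecov /omega_e7 /rho_plus !(hodgeD, hodgeN).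
rewrite (star3 1 2 7 [:: 3; 4; 5; 6] X)%N (star3 3 4 7 [:: 1; 2; 5; 6] X)%N.
rewrite (star3 5 6 7 [:: 1; 2; 3; 4] X)%N (star3 1 3 5 [:: 2; 4; 6; 7] X)%N.
rewrite (star3 1 4 6 [:: 2; 3; 5; 7] X)%N (star3 2 4 5 [:: 1; 3; 6; 7] X)%N.
rewrite (star3 2 3 6 [:: 1; 4; 5; 7] X)%N /psi_ecov /rho_minus7.
rewrite /=; ring.
Qed.

Lemma hodge_rho_minus7 : @hodge R 4 3 rho_minus7 =1 @rho_plus R 6.
Proof.
move=> X; rewrite /rho_minus7 !(hodgeD, hodgeN).
rewrite (star4 1 3 6 7 [:: 2; 4; 5] X)%N (star4 1 4 5 7 [:: 2; 3; 6] X)%N.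
rewrite (star4 2 3 5 7 [:: 1; 4; 6] X)%N (star4 2 4 6 7 [:: 1; 3; 5] X)%N.
rewrite /rho_plus /=; ring.
Qed.

Lemma hodge_psi : @hodge R 4 3 (@psi R) =1 phi_ecov.
Proof.
move=> X; rewrite (@eq_hodge _ 4 3 _ _ psiE) /psi_ecov 3!hodgeD hodge_rho_minus7.
rewrite (star4 3 4 5 6 [:: 1; 2; 7] X)%N (star4 1 2 5 6 [:: 3; 4; 7] X)%N.
rewrite (star4 1 2 3 4 [:: 5; 6; 7] X)%N /phi_ecov /omega_e7 /=; ring.
Qed.

Lemma alternating_rho_plus : alternating (@rho_plus R 6).
Proof.
by do ![apply: alternatingD | apply: alternatingN | exact: alternating_minor].
Qed.

Lemma alternating_phi_ecov : alternating phi_ecov.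
Proof.
rewrite /phi_ecov; apply: alternatingD; last exact: alternating_rho_plus.
by do ![apply: alternatingD | apply: alternatingN | exact: alternating_minor].
Qed.

End G2Forms.

(** * The action of u(3) *)

Section Unitary.
Variable R : realFieldType.

Definition det_rows3 (u v w : nat -> R) : R :=
    u 0%N * (v 1%N * w 2%N - v 2%N * w 1%N)
  - u 1%N * (v 0%N * w 2%N - v 2%N * w 0%N)
  + u 2%N * (v 0%N * w 1%N - v 1%N * w 0%N).

Lemma det_mx2 (x : nat -> nat -> R) :
  \det (\matrix_(i < 2, j < 2) x i j) = x 0%N 0%N * x 1%N 1%N - x 0%N 1%N * x 1%N 0%N.
Proof.
rewrite (expand_det_row _ ord0) !big_ord_recl big_ord0 /cofactor !det_mx11 !mxE /=.
by ring.
Qed.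

Lemma det_mx3 (x : nat -> nat -> R) :
  \det (\matrix_(i < 3, j < 3) x i j) = det_rows3 (x 0%N) (x 1%N) (x 2%N).
Proof.
rewrite (expand_det_row _ ord0) !big_ord_recl big_ord0 /cofactor.
have minorE (j : 'I_3) : row' ord0 (col' j (\matrix_(i < 3, j < 3) x i j)) =
    \matrix_(i < 2, k < 2) x i.+1 (bump j k).
  by apply/matrixP=> i k; rewrite !mxE.
rewrite !minorE !(det_mx2 (fun i k => x i.+1 (bump _ k))) !mxE /det_rows3 /= /bump /=.
ring.
Qed.

Lemma ecov2 n p q (X : 'M[R]_(n.+1, 2))
    (x := fun i m => X (inord i.-1) (inord m)) :
  ecov [:: p; q] X = x p 0%N * x q 1%N - x p 1%N * x q 0%N.
Proof.
rewrite -(det_mx2 (fun i m => x (nth 1%N [:: p; q] i) m)).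
by congr (\det _); apply/matrixP=> i m; rewrite !mxE /x inord_val.
Qed.

Lemma ecov3 n p q r (X : 'M[R]_(n.+1, 3))
    (x := fun i m => X (inord i.-1) (inord m)) :
  ecov [:: p; q; r] X = det_rows3 (x p) (x q) (x r).
Proof.
rewrite -[RHS](det_mx3 (fun i m => x (nth 1%N [:: p; q; r] i) m)).
by congr (\det _); apply/matrixP=> i m; rewrite !mxE /x inord_val.
Qed.

(** The Leibniz rule in the rows: [theta(B)] is a derivation of the exterior
    algebra, acting on [e^p] by [e^p |-> - e^p(B .)]. *)
Lemma theta_ecov3 n (B : 'M[R]_n.+1) p q r (X : 'M[R]_(n.+1, 3))
    (x := fun i m => X (inord i.-1) (inord m))
    (y := fun i m => (B *m X) (inord i.-1) (inord m)) :
  theta B (@ecov R n [:: p; q; r]) X =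
  - (det_rows3 (y p) (x q) (x r) + det_rows3 (x p) (y q) (x r) + det_rows3 (x p) (x q) (y r)).
Proof.
have sE (j : 'I_3) u i (m : nat) : (m < 3)%N -> subst_col j u X (inord i) (inord m) =
    if m == j then u (inord i) 0 else x i.+1 m.
  by move=> m3; rewrite mxE -val_eqE /= inordK.
have yE (j : 'I_3) i : (B *m col j X) (inord i) 0 = y i.+1 j.
  by rewrite /y inord_val !mxE; apply: eq_bigr => l _; rewrite mxE.
rewrite theta_subst_col !big_ord_recl big_ord0 !ecov3 /det_rows3 !sE // !yE /= /det_rows3 /x /y /=.
ring.
Qed.

(** In coordinates counted from 0, [J e_{2s} = e_{2s+1}] and
    [J e_{2s+1} = - e_{2s}]. *)
Lemma Jmx_entry (i j : 'I_6) : @Jmx R i j =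
  (odd i && (i == j.+1 :> nat))%:R - (odd j && (j == i.+1 :> nat))%:R.
Proof.
rewrite mxE /omega !ecov2.
have E0 (k : 'I_6) : @row_mx R 6 1 1 (delta_mx j 0) (delta_mx i 0) k (inord 0) = (k == j)%:R.
  have -> : inord 0 = lshift 1 ord0 :> 'I_(1 + 1) by apply: val_inj; rewrite /= inordK.
  by rewrite row_mxEl mxE eqxx andbT.
have E1 (k : 'I_6) : @row_mx R 6 1 1 (delta_mx j 0) (delta_mx i 0) k (inord 1) = (k == i)%:R.
  have -> : inord 1 = rshift 1 ord0 :> 'I_(1 + 1) by apply: val_inj; rewrite /= inordK.
  by rewrite row_mxEr mxE eqxx andbT.
rewrite !E0 !E1 -!val_eqE /= !inordK //.
by case: i j {E0 E1} => [[|[|[|[|[|[|i]]]]]] Hi] [[|[|[|[|[|[|j]]]]]] Hj] //=; ring.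
Qed.

Lemma sum6 (f : 'I_6 -> R) : \sum_l f l =
  f (inord 0) + f (inord 1) + f (inord 2) + f (inord 3) + f (inord 4) + f (inord 5).
Proof.
rewrite (eq_bigr (fun l : 'I_6 => f (inord l))) => [|l _]; last by rewrite inord_val.
by rewrite !big_ord_recr big_ord0 /= add0r.
Qed.

Definition ext6 (A : 'M[R]_6) : 'M[R]_7 := @block_mx R 6 1 6 1 A 0 0 0.

Lemma ext6_row k (A : 'M[R]_6) (X : 'M_(7, k)) i m : (i < 6)%N ->
  (ext6 A *m X) (inord i) m =
  let f l := A (inord i) (inord l) * X (inord l) m in
  f 0%N + f 1%N + f 2%N + f 3%N + f 4%N + f 5%N.
Proof.
move=> i6 /=.
transitivity (\sum_(l < 6) A (inord i) l * X (inord l) m); last first.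
  by rewrite sum6 !inordK.
rewrite mxE big_ord_recr /=.
have -> : inord i = @lshift 6 1 (inord i) :> 'I_7.
  by apply: val_inj; rewrite /= !inordK // ltnS ltnW.
have -> : ord_max = @rshift 6 1 ord0 :> 'I_7 by apply: val_inj.
rewrite [X in X * _]block_mxEur mxE mul0r addr0; apply: eq_bigr => l _.
have -> : widen_ord (leqnSn 6) l = @lshift 6 1 l by apply: val_inj.
rewrite [X in X * _]block_mxEul; congr (_ * X _ _).
by apply: val_inj; rewrite /= inordK // ltnS ltnW.
Qed.

Lemma ext6_row_max k (A : 'M[R]_6) (X : 'M_(7, k)) m : (ext6 A *m X) (inord 6) m = 0.
Proof.
have -> : inord 6 = @rshift 6 1 ord0 :> 'I_7 by apply: val_inj; rewrite /= inordK.
rewrite mxE big_ord_recr /= big1 => [|l _].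
  have -> : ord_max = @rshift 6 1 ord0 :> 'I_7 by apply: val_inj.
  by rewrite add0r [X in X * _]block_mxEdr mxE mul0r.
have -> : widen_ord (leqnSn 6) l = @lshift 6 1 l by apply: val_inj.
by rewrite [X in X * _]block_mxEdl mxE mul0r.
Qed.

Section UnitaryMatrix.
Variable A : 'M[R]_6.
Hypotheses (spA : sp6 A) (skA : A^T = - A).

(** The complex trace of [A] is [i ctrace]: the real parts of the diagonal
    entries vanish since [A] is skew-Hermitian. *)
Definition ctrace := A (inord 1) (inord 0) + A (inord 3) (inord 2) + A (inord 5) (inord 4).

Lemma skew_entry i j : A i j = - A j i.
Proof. by rewrite -[in LHS](trmxK A) skA !mxE. Qed.

Lemma skew_diag i : A i i = 0.
Proof.
by apply/eqP; rewrite -[_ == 0](@mulrn_eq0 R _ 2) mulr2n {2}skew_entry subrr.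
Qed.

(** A matrix that commutes with [J] consists of 2 x 2 blocks with rows
    [(u, - v)] and [(v, u)], which represent the complex numbers [u + i v]. *)
Lemma unitary_entries r s : (r < 3)%N -> (s < 3)%N ->
  A (inord r.*2) (inord s.*2.+1) = - A (inord r.*2.+1) (inord s.*2) /\
  A (inord r.*2.+1) (inord s.*2.+1) = A (inord r.*2) (inord s.*2).
Proof.
move=> r3 s3.
have comm i j : \sum_(l < 6) A i l * Jmx R l j = \sum_(l < 6) Jmx R i l * A l j.
  move/matrixP/(_ i j): spA.
  by rewrite skA mulmxN !mxE => /eqP; rewrite subr_eq0 => /eqP.
have := comm (inord r.*2) (inord s.*2); have := comm (inord r.*2) (inord s.*2.+1).
rewrite !sum6 !Jmx_entry.
by case: r r3 => [|[|[|]]] // _; case: s s3 => [|[|[|]]] // _; rewrite /= !inordK //=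
  !(mulr0, mul0r, subr0, sub0r, mulr1, mul1r, addr0, add0r, mulrN1, mulN1r) => /oppr_inj -> ->.
Qed.

(** [u(3)] preserves [omega] and acts on the complex volume form
    [rho^+ + i rho^-] by minus the complex trace.  In coordinates, the nine real
    parameters of [A] reduce both claims to polynomial identities in the entries
    of [X]. *)
Lemma theta_unitary (X : 'M_(7, 3)) :
  theta (ext6 A) (@omega_e7 R) X = 0 /\
  theta (ext6 A) (@rho_plus R 6) X = ctrace * rho_minus X.
Proof.
have Ue r s := unitary_entries (r:=r) (s:=s).
have [/= e00 f00] := Ue 0%N 0%N isT isT; have [/= e01 f01] := Ue 0%N 1%N isT isT.
have [/= e02 f02] := Ue 0%N 2%N isT isT; have [/= e10 f10] := Ue 1%N 0%N isT isT.
have [/= e11 f11] := Ue 1%N 1%N isT isT; have [/= e12 f12] := Ue 1%N 2%N isT isT.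
have [/= e20 f20] := Ue 2%N 0%N isT isT; have [/= e21 f21] := Ue 2%N 1%N isT isT.
have [/= e22 f22] := Ue 2%N 2%N isT isT.
have g i j := skew_entry (inord i) (inord j).
have d i := skew_diag (inord i).
(* Every entry is rewritten in terms of the blocks on and below the diagonal. *)
have entries := ((d 0, d 2, d 4), (e00, e01, e02), (e10, e11, e12), (e20, e21, e22),
  (f00, f01, f02), (f10, f11, f12), (f20, f21, f22), (g 0 2, g 0 4, g 2 4, g 1 2, g 1 4, g 3 4))%N.
rewrite /ctrace /rho_minus /rho_plus /omega_e7 !(thetaD, thetaN) !theta_ecov3 !ecov3 /det_rows3 /=.
rewrite !(ext6_row_max, ext6_row) //=.
rewrite /= in entries.
rewrite !entries.
by split; ring.
Qed.

End UnitaryMatrix.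
End Unitary.

(** * The Laplacian of psi and the soliton equation *)

Section Soliton.
Variable R : realFieldType.
Variable br : 'cV[R]_7 -> 'cV[R]_7 -> 'cV[R]_7.
Variable A : 'M[R]_6.
Hypothesis hg : almost_abelian br A.

Lemma inh_e7_decomp (x : 'cV[R]_7) :
  x = inh (@usubmx R 6 1 1 x) + x ord_max 0 *: e7 R.
Proof.
apply/matrixP=> i j; rewrite ord1 -[in LHS](@vsubmxK R 6 1 1 x) !mxE.
have -> : (i == ord_max) = (6 <= i)%N.
  by rewrite -val_eqE /= eqn_leq -ltnS ltn_ord.
case: splitP => k ik; rewrite !mxE ?ik /=.
  by rewrite leqNgt ltn_ord mulr0 addr0.
rewrite ?leq_addr mulr1 add0r; congr (x _ _).
by apply: val_inj; rewrite /= ord1.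
Qed.

Lemma ext6_mul x : ext6 A *m x = inh (A *m @usubmx R 6 1 1 x).
Proof.
have := mul_block_col A 0 0 (0 : 'M_1) (@usubmx R 6 1 1 x) (@dsubmx R 6 1 1 x).
by rewrite vsubmxK !mul0mx !addr0.
Qed.

Lemma bracketE x y :
  br x y = x ord_max 0 *: (ext6 A *m y) - y ord_max 0 *: (ext6 A *m x).
Proof.
have [[linl linr alt _] abel adE] := hg.
have br0l z : br 0 z = 0.
  by have := linl (-1) 0 0 z; rewrite scaler0 addr0 scaleN1r addNr.
have br0r z : br z 0 = 0.
  by have := linr (-1) z 0 0; rewrite scaler0 addr0 scaleN1r addNr.
have anti u v : br u v = - br v u.
  apply/eqP; rewrite -addr_eq0; apply/eqP.
  have := alt (1 *: u + v); rewrite linl !linr !alt !scale1r add0r addr0.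
  by [].
rewrite {1}(inh_e7_decomp x) {1}(inh_e7_decomp y).
rewrite addrC linl [_ + _ *: e7 R]addrC !linr abel alt scaler0 add0r addr0.
rewrite (anti (inh _)) !adE !ext6_mul scalerN.
by [].
Qed.

Lemma dform_almost_abelian k (a : 'M[R]_(7, k.+1) -> R) X : alternating a ->
  dform br a X =
  (-1) ^+ k.+1 * wedge1 (theta (ext6 A) a) (@ecov R 6 [:: 7]%N) X.
Proof.
move=> alta; rewrite (dform_rank_one X bracketE alta) mulr_sumr.
apply: eq_bigr => j _; rewrite [ecov _ _]det_mx11 !mxE /=.
have -> : inord 6 = ord_max :> 'I_7 by apply: val_inj; rewrite /= inordK.
rewrite !mulrA -exprD -mulrA [_ * theta _ _ _]mulrC mulrA; congr (_ * _ * _).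
by rewrite -[RHS]signr_odd oddD oddB -1?ltnS // addbA addbb addFb signr_odd.
Qed.

Hypotheses (spA : sp6 A) (skA : A^T = - A).

Lemma dform_rho_plus X :
  dform br (@rho_plus R 6) X = - ctrace A * rho_minus7 X.
Proof.
rewrite (dform_almost_abelian X (alternating_rho_plus R)) -wedge1_rho_minus.
rewrite -signr_odd expr1 mulN1r mulNr mulr_sumr; congr (- _).
apply: eq_bigr => j _; rewrite (theta_unitary spA skA _).2.
by rewrite [_ * (ctrace A * _)]mulrCA !mulrA.
Qed.

Lemma dform_phi X :
  dform br (@phi_ecov R) X = - ctrace A * rho_minus7 X.
Proof.
rewrite (dform_almost_abelian X (alternating_phi_ecov R)) -wedge1_rho_minus.
rewrite -signr_odd expr1 mulN1r mulNr mulr_sumr; congr (- _).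
apply: eq_bigr => j _; rewrite /phi_ecov thetaD.
rewrite (theta_unitary spA skA _).1 (theta_unitary spA skA _).2 add0r.
by rewrite [_ * (ctrace A * _)]mulrCA !mulrA.
Qed.

Hypothesis coclosed_br : coclosed br.

Lemma laplacian_psi X : laplacian4 br (@psi R) X = ctrace A ^+ 2 * rho_minus7 X.
Proof.
have codiff_psi : codiff4 br (@psi R) =1 fun Y => - ctrace A * @rho_plus R 6 Y.
  move=> Y; rewrite /codiff4 -hodge_rho_minus7 -hodgeZ.
  apply: (@eq_hodge _ 4 3) => Z; rewrite -dform_phi.
  by apply: eq_dform; apply: hodge_psi.
have codiff_dpsi : codiff5 br (dform br (@psi R)) X = 0.
  rewrite /codiff5 (@eq_hodge _ 3 4 _ (fun=> 0)) ?hodge0 ?oppr0 // => Y.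
  rewrite (@eq_dform _ _ _ br _ (fun=> 0)) ?dform0 // => Z.
  by rewrite (@eq_hodge _ 5 2 _ (fun=> 0) coclosed_br) hodge0.
rewrite /laplacian4 codiff_dpsi addr0 (eq_dform br codiff_psi) dform_scale.
by rewrite dform_rho_plus mulrA mulrNN.
Qed.

Definition e7_scaling (q : R) : 'M[R]_7 :=
  diag_mx (\row_i (if i == ord_max then q else 0)).

(** Only the monomials of [psi] that contain [e^7] see the scaling. *)
Lemma theta_psi q X : theta (e7_scaling q) (@psi R) X = - q * rho_minus7 X.
Proof.
rewrite (eq_theta _ (@psiE R)) /psi_ecov /rho_minus7 !(thetaD, thetaN).
rewrite !theta_diag_minor !big_ord_recl !big_ord0 !mxE -!val_eqE /= !inordK //=.
rewrite /ecov /minor; ring.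
Qed.

Lemma e7_scaling_mul q (x : 'cV[R]_7) : e7_scaling q *m x = (q * x ord_max 0) *: e7 R.
Proof.
rewrite mul_diag_mx; apply/matrixP=> i j; rewrite !mxE ord1 eqxx andbT.
by case: eqP => [->|_]; rewrite ?mulr1 // mul0r mulr0.
Qed.

(** The endomorphism is [0] on [e_7] and [- q] on [h], and every bracket lies in
    [h]: both sides of the Leibniz rule for [[e_7, x]] with [x] in [h] are
    [- q A x]. *)
Lemma derivation_e7_scaling q : derivation br (e7_scaling q - q%:M).
Proof.
move=> x y.
have ext6_max (z : 'cV[R]_7) : (ext6 A *m z) ord_max 0 = 0.
  by rewrite -(ext6_row_max A z 0); congr ((_ *m _) _ _); apply: val_inj; rewrite /= inordK.
have ext6_e7 : ext6 A *m e7 R = 0.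
  rewrite ext6_mul (_ : usubmx _ = 0) ?mulmx0 ?/inh ?col_mx0 //.
  by apply/matrixP=> i j; rewrite !mxE -val_eqE /= ltn_eqF.
have entryE (a b : R) (u v : 'cV[R]_7) k :
  (a *: u - b *: v) k 0 = a * u k 0 - b * v k 0 by rewrite !mxE.
have e7_max : e7 R ord_max 0 = 1 by rewrite mxE !eqxx.
rewrite !mulmxBl !mul_scalar_mx !e7_scaling_mul !bracketE !entryE !ext6_max e7_max.
rewrite !mulmxBr -!scalemxAr ext6_e7.
move: (ext6 A *m x) (ext6 A *m y) => u v.
apply/matrixP=> i j; rewrite !mxE; ring.
Qed.

Lemma skew_soliton : algebraic_soliton br.
Proof.
pose q := - ctrace A ^+ 2.
exists (e7_scaling q).
  split=> [|X]; first exact: tr_diag_mx.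
  by rewrite laplacian_psi theta_psi opprK.
have symD : (e7_scaling q - q%:M)^T = e7_scaling q - q%:M.
  by rewrite linearB /= tr_diag_mx tr_scalar_mx.
exists q, (e7_scaling q - q%:M); rewrite symD; split; try exact: derivation_e7_scaling.
rewrite -mulr2n -scaler_nat scalerA mulVf ?pnatr_eq0 // scale1r.
by rewrite addrC subrK.
Qed.

End Soliton.

Theorem corollary4p1 (R : realType)
    (br : 'cV[R]_7 -> 'cV[R]_7 -> 'cV[R]_7) (A : 'M[R]_6)
    (hg : almost_abelian br A) (hcoclosed : coclosed br)
    (hsp : sp6 A) (hskew : A^T = - A) :
  algebraic_soliton br.
Proof. exact: (skew_soliton hg hsp hskew hcoclosed). Qed.
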